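(* Let $k,h>0$, $t:=kh$ and $b:=1-t^2/2-\cos t$. If $kh\le\pi$ and $$\tau=\tau_o:=k\,\frac{\sqrt{\bigl(4b(t^2+18)+3t^4\bigr)^2+\bigl(4b(t^3+6t)+2t^5\bigr)^2}-\bigl(4b(t^2+18)+3t^4\bigr)}{4b(t^3+6t)+2t^5},$$ then the discrete wave number $k_h$ of the linear HDG method with penalty parameter $\tau$ on the equidistant one-dimensional grid of mesh size $h$ satisfies $k_h=k$.
   Context: **Discrete wave number.** For the homogeneous 1D Helmholtz equation $-u''-k^2u=0$ on an equidistant grid $x_i=ih$, the linear HDG method with constant penalty parameter $\tau$, after elimination of all unknowns except the nodal numerical trace values $\hat u_i$, gives at each interior node $$F_h(\hat u_h,k):=S\hat u_{i-1}+R\hat u_i+S\hat u_{i+1}=0,$$ $$S=-1-\frac{k^2h^2(12\tau h-3k^2h^2+2\tau^2h^2)}{(12+2\tau h-k^2h^2)(6\tau h-k^2h^2)},\qquad R=2-\frac{2k^2h^2(24\tau h-3k^2h^2+4\tau^2h^2-k^2h^2\tau h)}{(12+2\tau h-k^2h^2)(6\tau h-k^2h^2)}.$$ For a given wave number $k$ and a given value of $\tau$, the discrete wave number $k_h$ is the solution of $F_h(I_he^{\mathbf i kx},k_h)=0$ on the solution branch near $k$; here $I_h e^{\mathbf i kx}$ has nodal values $e^{\mathbf i kx_i}$, the value of $\tau$ is kept fixed, and $k$ is replaced by $k_h$ in $S$ and $R$. With $t=kh$, $t_h=k_hh$, $s=\tau h$ this equation reads, after clearing denominators, $$2(12+2s-t_h^2)(6s-t_h^2)(1-\cos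 t)-2t_h^2\bigl(24s-3t_h^2+4s^2-t_h^2s+(12s-3t_h^2+2s^2)\cos t\bigr)=0,$$ a quadratic equation for $t_h^2$. ''The branch near $k$'' means: $t_h^2$ is the root for which $|t_h^2-t^2|$ is smallest, $t_h$ is the square root of $t_h^2$ closest to $t$, and $k_h=t_h/h$. *)

(* Defs.v *)
From Stdlib Require Import Reals ZArith.
From Coquelicot Require Import Coquelicot.

Open Scope R_scope.

(** Grid functions live on the whole grid [x_i = i h], [i] in [Z], so that every
    node is interior.  The wave-number argument [kappa] is complex because the
    dispersion equation may have non-real solutions; the penalty [tau] and the
    mesh size [h] are real. *)

Definition hdg_den (h tau : R) (kappa : C) : C :=
  ((12 + 2 * (tau * h) - kappa ^ 2 * h ^ 2)
   * (6 * (tau * h) - kappa ^ 2 * h ^ 2))%C.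

Definition hdg_S (h tau : R) (kappa : C) : C :=
  (- (1)
   - (kappa ^ 2 * h ^ 2
      * (12 * (tau * h) - 3 * (kappa ^ 2 * h ^ 2) + 2 * (tau ^ 2 * h ^ 2)))
     / hdg_den h tau kappa)%C.

Definition hdg_R (h tau : R) (kappa : C) : C :=
  (2
   - (2 * (kappa ^ 2 * h ^ 2)
      * (24 * (tau * h) - 3 * (kappa ^ 2 * h ^ 2) + 4 * (tau ^ 2 * h ^ 2)
         - kappa ^ 2 * h ^ 2 * (tau * h)))
     / hdg_den h tau kappa)%C.

Definition hdg_F (h tau : R) (u : Z -> C) (kappa : C) (i : Z) : C :=
  (hdg_S h tau kappa * u (i - 1)%Z + hdg_R h tau kappa * u i
   + hdg_S h tau kappa * u (i + 1)%Z)%C.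

Definition nodal_interp (h : R) (f : R -> C) (i : Z) : C := f (IZR i * h).

(** [exp (i k x)], in Cartesian form. *)
Definition plane_wave (k x : R) : C := (cos (k * x), sin (k * x)).

(** The left-hand side of the dispersion equation [F_h (I_h exp(ikx), k_h) = 0]
    after clearing denominators, with [t = k h], [s = tau h] and [T = (k_h h)^2]. *)
Definition dispersion_poly (t s : R) (T : C) : C :=
  (2 * (12 + 2 * s - T) * (6 * s - T) * (1 - cos t)
   - 2 * T * (24 * s - 3 * T + 4 * s ^ 2 - T * s
              + (12 * s - 3 * T + 2 * s ^ 2) * cos t))%C.

Definition nearest (P : C -> Prop) (z0 z : C) : Prop :=
  P z /\ forall w : C, P w -> Cmod (z - z0) <= Cmod (w - z0).

(** The condition on [hdg_den] says that [hdg_S] and [hdg_R] are defined at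
    [kh]; otherwise division by zero would take a junk value. *)
Definition is_discrete_wave_number (h tau k : R) (kh : C) : Prop :=
  hdg_den h tau kh <> 0%C /\
  (forall i : Z, hdg_F h tau (nodal_interp h (plane_wave k)) kh i = 0%C) /\
  nearest (fun T => dispersion_poly (k * h) (tau * h) T = 0%C)
    (RtoC ((k * h) ^ 2)) ((kh * h) ^ 2)%C /\
  nearest (fun z => (z ^ 2)%C = ((kh * h) ^ 2)%C) (RtoC (k * h)) (kh * h)%C.

Definition optimal_tau (k h : R) : R :=
  let t := k * h in
  let b := 1 - t ^ 2 / 2 - cos t in
  let p := 4 * b * (t ^ 2 + 18) + 3 * t ^ 4 in
  let q := 4 * b * (t ^ 3 + 6 * t) + 2 * t ^ 5 in
  k * ((sqrt (p ^ 2 + q ^ 2) - p) / q).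

(* Main.v *)
(** At [T = t^2] the dispersion equation is itself a quadratic in [s = tau h]: with
    [p], [q] as in [optimal_tau], it reads [t (q x^2 + 2 p x - q) = 0] for
    [s = t x], and [optimal_tau] is its positive root once [q > 0].  So [t^2]
    is an exact root, and being at distance [0] from itself it is the unique
    nearest one; likewise [t] is the unique nearest square root.  The other root
    of the dispersion equation never has to be located. *)

Require Import Defs.
From Stdlib Require Import Reals ZArith Lra Psatz.
From Coquelicot Require Import Coquelicot.

Open Scope R_scope.

(** Peels factorials apart over the reals, so that [8!] is never computed as a unary natural. *)
Lemma INR_fact_S (n : nat) : INR (fact (S n)) = INR (S n) * INR (fact n).
Proof. now rewrite fact_simpl, mult_INR. Qed.

Lemma cos_le_taylor8 (y : R) (hy : -2 <= y <= 2) :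
  cos y <= 1 - y ^ 2 / 2 + y ^ 4 / 24 - y ^ 6 / 720 + y ^ 8 / 40320.
Proof.
  (* Index 1 selects the upper sum with terms 0 to 4, hence degree 8. *)
  destruct (pre_cos_bound y 1 ltac:(lra) ltac:(lra)) as [_ Hu].
  unfold cos_approx, cos_term in Hu; cbn [sum_f_R0 Nat.mul Nat.add] in Hu.
  rewrite !INR_fact_S in Hu; change (fact 0) with 1%nat in Hu; simpl INR in Hu; lra.
Qed.

Lemma sin_ge_taylor7 (y : R) (hy : 0 <= y <= 4) :
  y - y ^ 3 / 6 + y ^ 5 / 120 - y ^ 7 / 5040 <= sin y.
Proof.
  destruct (pre_sin_bound y 1 ltac:(lra) ltac:(lra)) as [Hl _].
  unfold sin_approx, sin_term in Hl; cbn [sum_f_R0 Nat.mul Nat.add] in Hl.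
  rewrite !INR_fact_S in Hl; change (fact 0) with 1%nat in Hl; simpl INR in Hl; lra.
Qed.

(** Cosine is nonnegative up to [PI / 2], but its Taylor upper bound is already negative at 1.58; so
    [PI < 3.16], and 3.16^2 = 9.9856. *)
Lemma PI_sqr_lt_10 : PI ^ 2 < 10.
Proof.
  assert (H : PI / 2 < 158 / 100).
  { destruct (Rlt_le_dec (PI / 2) (158 / 100)) as [H | H]; [exact H | exfalso].
    assert (Hc : 0 <= cos (158 / 100)) by (apply cos_ge_0; lra).
    pose proof (cos_le_taylor8 (158 / 100) ltac:(lra)); lra. }
  pose proof PI_RGT_0; nra.
Qed.

Lemma one_sub_cos (t : R) : 1 - cos t = 2 * sin (t / 2) ^ 2.
Proof.
  replace (cos t) with (cos (2 * (t / 2))) by (f_equal; field).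
  rewrite cos_2a_sin; ring.
Qed.

(** The positive quantity is [q / (2 t)].  At [t = PI] the margin is only about 4%,
    which is why degree-7 Taylor bounds and [PI ^ 2 < 10] are needed. *)
Lemma optimal_tau_denominator_pos (t : R) (ht0 : 0 < t) (ht : t <= PI) :
  0 < 2 * (1 - t ^ 2 / 2 - cos t) * (t ^ 2 + 6) + t ^ 4.
Proof.
  pose proof PI_sqr_lt_10 as HPI.
  replace (1 - t ^ 2 / 2 - cos t) with (2 * sin (t / 2) ^ 2 - t ^ 2 / 2)
    by (rewrite <- one_sub_cos; ring).
  set (y := t / 2). replace t with (2 * y) by (unfold y; field).
  assert (Hy : 0 < y) by (unfold y; lra).
  assert (Hz : 0 < y ^ 2 <= 5 / 2) by (unfold y; nra).
  pose proof (sin_ge_taylor7 y ltac:(nra)) as Hs.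
  set (z := y ^ 2) in *.
  (* Chosen so that the degree-7 bound reads [y * (1 - z * m) <= sin y]. *)
  set (m := 1 / 6 - z / 120 + z ^ 2 / 5040).
  (* A linear majorant on [0 < z <= 5 / 2]: there 1/120 - z/5040 is at least 0.00783. *)
  assert (Hm : m <= 1 / 6 - 78 / 10000 * z) by (unfold m; nra).
  assert (Hm0 : 0 < m) by (unfold m; nra).
  assert (Hl : y * (1 - z * m) <= sin y) by (unfold m, z in *; lra).
  assert (Hl2 : z * (1 - z * m) ^ 2 <= sin y ^ 2).
  { replace (z * (1 - z * m) ^ 2) with ((y * (1 - z * m)) ^ 2) by (unfold z; ring).
    apply pow_incr; split; [apply Rmult_le_pos; nra | exact Hl]. }
  (* Inserting [Hl2] bounds the goal's expression below by [8 * z ^ 2 * (2 - m * (2 - z * m) * (2 *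
     z + 3))]. As [m * (2 - z * m)] increases in [m] while [z * m <= 1], [m] may be replaced by its
     majorant [n], leaving a cubic in [z]. *)
  assert (Hk : m * (2 - z * m) * (2 * z + 3) < 2).
  { set (n := 1 / 6 - 78 / 10000 * z) in *.
    assert (m * (2 - z * m) <= n * (2 - z * n)).
    { assert (0 <= (n - m) * (2 - z * (n + m))) by (apply Rmult_le_pos; unfold n in *; nra).
      nra. }
    assert (n * (2 - z * n) * (2 * z + 3) < 2) by (unfold n; nra).
    nra. }
  replace ((2 * y) ^ 2) with (4 * z) by (unfold z; ring).
  replace ((2 * y) ^ 4) with (16 * z ^ 2) by (unfold z; ring).
  assert (0 < z ^ 2 * (2 - m * (2 - z * m) * (2 * z + 3))) by (apply Rmult_lt_0_compat; nra).
  nra.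
Qed.

Lemma quadratic_root (p q : R) (hq : 0 < q) :
  let x := (sqrt (p ^ 2 + q ^ 2) - p) / q in
  0 < x /\ q * x ^ 2 + 2 * p * x - q = 0.
Proof.
  intros x; unfold x.
  assert (Hsq : sqrt (p ^ 2 + q ^ 2) ^ 2 = p ^ 2 + q ^ 2) by (apply pow2_sqrt; nra).
  pose proof (sqrt_pos (p ^ 2 + q ^ 2)) as Hr.
  set (r := sqrt (p ^ 2 + q ^ 2)) in *.
  split.
  - apply Rdiv_lt_0_compat; nra.
  - replace (q * ((r - p) / q) ^ 2 + 2 * p * ((r - p) / q) - q)
      with ((r ^ 2 - p ^ 2 - q ^ 2) / q) by (field; lra).
    rewrite Hsq; field; lra.
Qed.

Lemma optimal_tau_spec (k h : R) (hk : 0 < k) (hh : 0 < h) (hkh : k * h <= PI) :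
  let t := k * h in
  let s := optimal_tau k h * h in
  let c := cos t in
  0 < s /\
  2 * (12 + 2 * s - t ^ 2) * (6 * s - t ^ 2) * (1 - c)
  - 2 * t ^ 2 * (24 * s - 3 * t ^ 2 + 4 * s ^ 2 - t ^ 2 * s
                 + (12 * s - 3 * t ^ 2 + 2 * s ^ 2) * c) = 0.
Proof.
  intros t s c.
  assert (Ht : 0 < t) by (apply Rmult_lt_0_compat; assumption).
  pose proof (optimal_tau_denominator_pos t Ht hkh) as Hb.
  unfold s, optimal_tau; cbv zeta; fold t; fold c in Hb |- *.
  set (b := 1 - t ^ 2 / 2 - c) in *.
  set (p := 4 * b * (t ^ 2 + 18) + 3 * t ^ 4).
  set (q := 4 * b * (t ^ 3 + 6 * t) + 2 * t ^ 5).
  assert (Hq : 0 < q) by (unfold q; nra).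
  destruct (quadratic_root p q Hq) as [Hx Hroot].
  set (x := (sqrt (p ^ 2 + q ^ 2) - p) / q) in *.
  replace (k * x * h) with (t * x) by (unfold t; ring).
  split; [now apply Rmult_lt_0_compat |].
  replace c with (1 - t ^ 2 / 2 - b) by (unfold b; ring).
  transitivity (t * (q * x ^ 2 + 2 * p * x - q)); [unfold p, q; field | rewrite Hroot; ring].
Qed.

Lemma hdg_den_factors_neq_0 (t s : R) (ht0 : 0 < t) (ht : t <= PI) (hs : 0 < s)
    (hroot : 2 * (12 + 2 * s - t ^ 2) * (6 * s - t ^ 2) * (1 - cos t)
             - 2 * t ^ 2 * (24 * s - 3 * t ^ 2 + 4 * s ^ 2 - t ^ 2 * s
                            + (12 * s - 3 * t ^ 2 + 2 * s ^ 2) * cos t) = 0) :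
  (12 + 2 * s - t ^ 2) * (6 * s - t ^ 2) <> 0.
Proof.
  pose proof PI_sqr_lt_10 as HPI.
  assert (Ht2 : t ^ 2 < 10) by nra.
  apply Rmult_integral_contrapositive_currified; [nra |].
  (* If [t^2 = 6 s], the dispersion equation forces [s = 3], i.e. [t^2 = 18 > PI^2]. *)
  intros H6; replace (t ^ 2) with (6 * s) in * by lra.
  assert (Hc : 0 < 1 - cos t).
  { rewrite one_sub_cos.
    assert (0 < sin (t / 2)) by (apply sin_gt_0; lra). nra. }
  (* With [t ^ 2 = 6 * s] the left side of [hroot] collapses to
     [-24 * s ^ 2 * (3 - s) * (1 - cos t)], and [6 * s < 10] gives [s < 3]. *)
  assert (0 < s * (s * ((3 - s) * (1 - cos t)))) by (repeat apply Rmult_lt_0_compat; lra).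
  nra.
Qed.

Lemma plane_wave_neighbours (k h : R) (i : Z) :
  let u := nodal_interp h (plane_wave k) in
  (u (i - 1)%Z + u (i + 1)%Z = 2 * cos (k * h) * u i)%C.
Proof.
  intros u; unfold u, nodal_interp, plane_wave.
  rewrite minus_IZR, plus_IZR.
  replace (k * ((IZR i - 1) * h)) with (k * (IZR i * h) - k * h) by ring.
  replace (k * ((IZR i + 1) * h)) with (k * (IZR i * h) + k * h) by ring.
  rewrite cos_minus, cos_plus, sin_minus, sin_plus.
  apply injective_projections; simpl; ring.
Qed.

(** A plane wave is an eigenfunction of the neighbour sum, with eigenvalue [2 * cos (k * h)], so the
    stencil multiplies it by the scalar [2 S cos t + R]. The equations at all nodes thus reduce to
    one polynomial equation. *)
Lemma hdg_F_plane_wave (h tau k : R) (kappa : C) (i : Z)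
    (hden : hdg_den h tau kappa <> 0%C) :
  hdg_F h tau (nodal_interp h (plane_wave k)) kappa i
  = (dispersion_poly (k * h) (tau * h) ((kappa * h) ^ 2)
     / hdg_den h tau kappa * nodal_interp h (plane_wave k) i)%C.
Proof.
  unfold hdg_F.
  transitivity
    ((2 * hdg_S h tau kappa * cos (k * h) + hdg_R h tau kappa)
     * nodal_interp h (plane_wave k) i)%C.
  - pose proof (plane_wave_neighbours k h i) as Hu; cbv zeta in Hu.
    transitivity
      (hdg_S h tau kappa * (nodal_interp h (plane_wave k) (i - 1)
                            + nodal_interp h (plane_wave k) (i + 1))
       + hdg_R h tau kappa * nodal_interp h (plane_wave k) i)%C;
      [ring | rewrite Hu; ring].
  - f_equal.
    assert (Hpoly : dispersion_poly (k * h) (tau * h) ((kappa * h) ^ 2)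
      = (2 * hdg_den h tau kappa * (1 - cos (k * h))
         - 2 * (kappa ^ 2 * h ^ 2)
           * (24 * (tau * h) - 3 * (kappa ^ 2 * h ^ 2) + 4 * (tau ^ 2 * h ^ 2)
              - kappa ^ 2 * h ^ 2 * (tau * h)
              + (12 * (tau * h) - 3 * (kappa ^ 2 * h ^ 2)
                 + 2 * (tau ^ 2 * h ^ 2)) * cos (k * h)))%C).
    { unfold dispersion_poly, hdg_den; rewrite RtoC_mult; ring. }
    rewrite Hpoly; unfold hdg_S, hdg_R; field; exact hden.
Qed.

Lemma nearest_self (P : C -> Prop) (z0 z : C) (h0 : P z0) : nearest P z0 z <-> z = z0.
Proof.
  split.
  - intros [_ Hmin]; specialize (Hmin z0 h0).
    replace (z0 - z0)%C with (RtoC 0) in Hmin by ring.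
    rewrite Cmod_0 in Hmin.
    apply Ceq_minus, Cmod_eq_0, Rle_antisym; [exact Hmin | apply Cmod_ge_0].
  - intros ->; split; [exact h0 |]; intros w _.
    replace (z0 - z0)%C with (RtoC 0) by ring.
    rewrite Cmod_0; apply Cmod_ge_0.
Qed.

Theorem lemma6p1 (k h tau : R) (hk : 0 < k) (hh : 0 < h) (hkh : k * h <= PI)
    (htau : tau = optimal_tau k h) :
  forall kh : C, is_discrete_wave_number h tau k kh <-> kh = RtoC k.
Proof.
  intros kh.
  destruct (optimal_tau_spec k h hk hh hkh) as [Hs Hroot]; rewrite <- htau in Hs, Hroot.
  pose proof (Rmult_lt_0_compat _ _ hk hh) as Ht.
  assert (Hpoly : dispersion_poly (k * h) (tau * h) (RtoC ((k * h) ^ 2)) = 0%C).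
  { unfold dispersion_poly; rewrite <- Hroot.
    repeat rewrite ?RtoC_minus, ?RtoC_plus, ?RtoC_mult, ?RtoC_pow; ring. }
  assert (Hden : hdg_den h tau k <> 0%C).
  { pose proof (hdg_den_factors_neq_0 _ _ Ht hkh Hs Hroot) as Hne.
    intros H0; apply Hne, RtoC_inj; rewrite <- H0; unfold hdg_den.
    repeat rewrite ?RtoC_minus, ?RtoC_plus, ?RtoC_mult, ?RtoC_pow; ring. }
  assert (Hkh2 : ((k * h) ^ 2)%C = RtoC ((k * h) ^ 2)) by now rewrite RtoC_pow, RtoC_mult.
  assert (Hh : RtoC h <> 0%C) by (intros H; apply RtoC_inj in H; lra).
  pose proof (nearest_self (fun T => dispersion_poly (k * h) (tau * h) T = 0%C) _
                ((kh * h) ^ 2)%C Hpoly) as HT.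
  unfold is_discrete_wave_number; rewrite HT.
  (* Once the squares agree, [k * h] is itself a candidate square root, at distance 0. *)
  assert (Hroots : ((kh * h) ^ 2)%C = RtoC ((k * h) ^ 2) ->
    nearest (fun z => (z ^ 2)%C = ((kh * h) ^ 2)%C) (RtoC (k * h)) (kh * h)%C
    <-> (kh * h)%C = RtoC (k * h)).
  { intros H2; apply nearest_self; rewrite H2; symmetry; apply RtoC_pow. }
  split.
  - intros (_ & _ & H2 & Hnear).
    apply (Hroots H2) in Hnear; rewrite RtoC_mult in Hnear.
    transitivity (kh * h / h)%C; [field; exact Hh | rewrite Hnear; field; exact Hh].
  - intros ->; split; [exact Hden |]; split; [| split].
    + intros i; rewrite hdg_F_plane_wave by exact Hden.
      rewrite Hkh2, Hpoly; unfold Cdiv; ring.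
    + exact Hkh2.
    + apply (Hroots Hkh2); symmetry; apply RtoC_mult.
Qed.
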